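(* For all integers $m,n\ge0$ there is a bijection $$\phi:\mathcal{D}(m,n)\to \mathcal{D}(m,n-2m)\cup\mathcal{D}(m-1,n-2m+1)\cup\mathcal{D}(m-2,n-2m+2).$$ In particular, writing $D(m,n)=|\mathcal{D}(m,n)|$, $$D(m,n)=D(m,n-2m)+D(m-1,n-2m+1)+D(m-2,n-2m+2).$$
   Context: A Schur partition is a partition of an integer into positive parts such that consecutive parts differ by at least $3$, and no two consecutive parts differing by exactly $3$ are both multiples of $3$. For a partition $\pi$, $m(\pi)$ is the number of parts of $\pi$ plus the number of even parts of $\pi$. $\mathcal{D}(m,n)$ is the set of Schur partitions $\pi$ of $n$ with $m(\pi)=m$; sets with a negative index are empty, and $\mathcal{D}(0,0)$ consists of the empty partition. *)

(* Defs.v *)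
From mathcomp Require Export all_boot all_order all_algebra.
From mathcomp Require Export finmap.
From mathcomp Require Export boolp classical_sets functions cardinality.

Set Implicit Arguments.
Unset Strict Implicit.
Unset Printing Implicit Defensive.
Import Order.TTheory GRing.Theory Num.Theory.
Local Open Scope classical_set_scope.

(* A partition is the list of its parts in nonincreasing order. *)
Definition is_partition (s : seq nat) : bool := sorted geq s && (0 \notin s).

Definition schur_gap (x y : nat) : bool :=
  (y + 3 <= x) && ~~ [&& x == y + 3, 3 %| x & 3 %| y].

Definition is_schur_partition (s : seq nat) : bool :=
  is_partition s && sorted schur_gap s.

Definition schur_weight (s : seq nat) : nat :=
  size s + count (fun x => ~~ odd x) s.

(* The indices range over int, so that the set is empty as soon as one of them
   is negative. *)
Definition schurD (m n : int) : set (seq nat) :=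
  [set s | [/\ is_schur_partition s, m = Posz (schur_weight s)
             & n = Posz (sumn s)]].

(* fset_set A is a junk value for infinite A; the sets counted here are finite. *)
Lemma finite_schurD (m n : int) : finite_set (schurD m n).
Proof.
case: n => n; last by apply: (@sub_finite_set _ _ set0) => // s [].
pose f (p : {k : 'I_n.+1 & k.-tuple 'I_n.+1}) : seq nat :=
  map val (tagged p).
apply: (@sub_finite_set _ _ (f @` setT)); last exact/finite_image/finite_finset.
move=> s [/andP[/andP[_ s0] _] _ [n_s]].
have size_le (t : seq nat) : 0 \notin t -> size t <= sumn t.
  elim: t => //= x t IH; rewrite inE negb_or eq_sym => /andP[x0 /IH].
  by rewrite -lt0n in x0; rewrite -add1n; apply: leq_add.
have mem_le (t : seq nat) x : x \in t -> x <= sumn t.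
  elim: t => //= y t IH; rewrite inE => /predU1P[->|/IH]; first exact: leq_addr.
  by move/leq_trans; apply; apply: leq_addl.
have sn : size s < n.+1 by rewrite ltnS n_s size_le.
have sz : size (map (@inord n) s) == Ordinal sn by rewrite size_map.
exists (Tagged (fun k : 'I_n.+1 => k.-tuple 'I_n.+1) (Tuple sz)) => //.
rewrite /f /= -map_comp -[RHS]map_id; apply/eq_in_map => x xs /=.
by rewrite inordK // ltnS n_s mem_le.
Qed.

Definition card_schurD (m n : int) : nat := #|` fset_set (schurD m n)|.

(* Main.v *)
(* Let d_N(x, q) be the generating function, by weight m(pi) and by size, of the
   Schur partitions whose parts are at most N. Splitting off the largest part
   gives d_N = d_(N-1) + x^e q^N d_M with e = 1 or 2 for N odd or even, and
   M = N - 4 or N - 3 according to whether 3 divides N. The theorem is the limit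
   k -> oo of the exact finite identity
     d_(2k)(x, q) = (1 + x q + x^2 q^2) d_(2k-3)(x q^2, q),
   proved by induction on k in steps of three: modulo 6, the recurrence expresses
   both sides through the three previous instances. The three sets on the
   right are disjoint because their weights differ, so the equality of
   cardinals yields the bijection. *)

From HB Require Import structures.
Require Import Defs.
From mathcomp Require Import zify ring.

Import Order.TTheory GRing.Theory Num.Theory.

Local Open Scope classical_set_scope.
Local Open Scope ring_scope.

(** Testing [x] alone suffices: at distance 3, [y] is a multiple of 3 exactly when [x] is. The
    offset counts from [x.-1], to fit a recursion on [N.+1]. *)
Definition schur_skip (x : nat) : nat := if (3 %| x)%N then 3%N else 2%N.

(* The branching on [3 %| N] is kept outside the recursive calls for the guard
   condition. *)
Fixpoint schur_upto (N : nat) : seq (seq nat) :=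
  if N is N'.+1 then
    schur_upto N' ++
    [seq N :: s | s <- if (3 %| N)%N then schur_upto (N' - 3)
                       else schur_upto (N' - 2)]
  else [:: [::]].

Lemma schur_uptoS N :
  schur_upto N.+1 =
  schur_upto N ++ [seq N.+1 :: s | s <- schur_upto (N - schur_skip N.+1)].
Proof. by rewrite /= /schur_skip; case: ifP. Qed.

(** Truncation of the bound to 0 is harmless: parts are positive, so it just forces [s] to be
    empty. *)
Lemma is_schur_cons x s : is_schur_partition (x :: s) =
  [&& (0 < x)%N, is_schur_partition s & (head 0%N s <= x.-1 - schur_skip x)%N].
Proof.
rewrite /is_schur_partition /is_partition in_cons negb_or /=.
case: s => [|y s] /=; first by rewrite !andbT /=; lia.
rewrite in_cons negb_or /schur_gap /schur_skip eqn_leq /geq /=.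
case: (path _ y s); last by rewrite !(andbF, andFb).
case: (path _ y s); last by rewrite !(andbF, andFb).
case: (0%N \notin s); last by rewrite !(andbF, andFb).
by case: ifP; lia.
Qed.

Lemma mem_schur_upto N s :
  (s \in schur_upto N) = is_schur_partition s && (head 0%N s <= N)%N.
Proof.
elim/ltn_ind: N s => -[|N] IH s.
  by case: s => [|[|x] s] //; rewrite is_schur_cons inE /= ?andbF.
rewrite schur_uptoS mem_cat IH //.
case: s => [|x s]; first by rewrite orbC; apply/esym; rewrite orbT.
have memE : (x :: s \in [seq N.+1 :: t | t <- schur_upto (N - schur_skip N.+1)])
    = (x == N.+1) && (s \in schur_upto (N - schur_skip N.+1)).
  apply/mapP/andP => [[t tN [-> ->]]|[/eqP-> sN]]; last by exists s.
  by rewrite eqxx.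
rewrite memE /=; case: (ltngtP x N.+1) => [xN|xN|->].
- by case: is_schur_partition => /=; lia.
- by case: is_schur_partition => /=; lia.
rewrite IH ?ltnS ?leq_subr // is_schur_cons /=.
by case: is_schur_partition => /=; lia.
Qed.

Lemma uniq_schur_upto N : uniq (schur_upto N).
Proof.
elim/ltn_ind: N => -[|N] IH //; rewrite schur_uptoS cat_uniq IH //=.
rewrite map_inj_uniq ?IH ?ltnS ?leq_subr //; last by move=> s t [].
rewrite andbT; apply/hasPn => _ /mapP[s _ ->].
by rewrite mem_schur_upto /= ltnn andbF.
Qed.

Section GeneratingFunction.
Variable R : comNzRingType.
Implicit Types x q : R.

Definition schur_gf x q (N : nat) : R :=
  \sum_(s <- schur_upto N) x ^+ schur_weight s * q ^+ sumn s.

Lemma schur_gf0 x q : schur_gf x q 0 = 1.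
Proof. by rewrite /schur_gf big_seq1 mulr1. Qed.

Lemma schur_gfS x q N : schur_gf x q N.+1 = schur_gf x q N +
  x ^+ (~~ odd N.+1).+1 * q ^+ N.+1 *
    schur_gf x q (N - schur_skip N.+1).
Proof.
rewrite {1}/schur_gf schur_uptoS big_cat big_map /=; congr (_ + _).
rewrite mulr_sumr; apply: eq_bigr => s _.
have -> : schur_weight (N.+1 :: s) = ((~~ odd N.+1).+1 + schur_weight s)%N.
  by rewrite /schur_weight /=; lia.
by rewrite [sumn _]/= !exprD; ring.
Qed.

(** Parity and divisibility by 3 of the new part depend only on [k]. The factor [q ^+ (6 * j)] is
    kept apart so that [ring] can treat it as an atom. *)
Lemma schur_gf_step x q j k N :
  N = (6 * j + k - schur_skip k.+1)%N ->
  schur_gf x q (6 * j + k.+1) = schur_gf x q (6 * j + k) +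
    x ^+ (~~ odd k.+1).+1 * (q ^+ (6 * j) * q ^+ k.+1) * schur_gf x q N.
Proof.
move=> ->; rewrite addnS schur_gfS -!addnS exprD oddD oddM /=.
by rewrite /schur_skip dvdn_addr ?dvdn_mulr.
Qed.

(* At [j = 0] the index [6 * j - 1] truncates to [0], harmlessly since the
   only Schur partition counted is then the empty one either way. *)
Lemma schur_gf_recurrence x q j :
  let y := x * q ^+ 2 in let t := 1 + x * q + x ^+ 2 * q ^+ 2 in
  [/\ schur_gf x q (6 * j + 2) = t * schur_gf y q (6 * j - 1),
      schur_gf x q (6 * j + 4) = t * schur_gf y q (6 * j + 1) &
      schur_gf x q (6 * j + 6) = t * schur_gf y q (6 * j + 3)].
Proof.
move=> y t; elim: j => [|j [IH2 IH4 IH6]].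
  by rewrite !(schur_gfS, schur_gf0) /= /t /y; split; ring.
have -> : (6 * j.+1 + 2 = 6 * j + 8)%N by lia.
have -> : (6 * j.+1 + 4 = 6 * j + 10)%N by lia.
have -> : (6 * j.+1 + 6 = 6 * j + 12)%N by lia.
have -> : (6 * j.+1 - 1 = 6 * j + 5)%N by lia.
have -> : (6 * j.+1 + 1 = 6 * j + 7)%N by lia.
have -> : (6 * j.+1 + 3 = 6 * j + 9)%N by lia.
have dS := @schur_gf_step x q j; have eS := @schur_gf_step y q j.
have e2 := eS 1%N (6 * j - 1)%N ltac:(rewrite /schur_skip /=; lia).
have e3 := eS 2%N (6 * j - 1)%N ltac:(rewrite /schur_skip /=; lia).
have e4 := eS 3%N (6 * j + 1)%N ltac:(rewrite /schur_skip /=; lia).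
have e5 := eS 4%N (6 * j + 2)%N ltac:(rewrite /schur_skip /=; lia).
have e6 := eS 5%N (6 * j + 2)%N ltac:(rewrite /schur_skip /=; lia).
have e7 := eS 6%N (6 * j + 4)%N ltac:(rewrite /schur_skip /=; lia).
have e8 := eS 7%N (6 * j + 5)%N ltac:(rewrite /schur_skip /=; lia).
have e9 := eS 8%N (6 * j + 5)%N ltac:(rewrite /schur_skip /=; lia).
have d5 := dS 4%N (6 * j + 2)%N ltac:(rewrite /schur_skip /=; lia).
have d7 := dS 6%N (6 * j + 4)%N ltac:(rewrite /schur_skip /=; lia).
have d8 := dS 7%N (6 * j + 5)%N ltac:(rewrite /schur_skip /=; lia).
have d9 := dS 8%N (6 * j + 5)%N ltac:(rewrite /schur_skip /=; lia).
have d10 := dS 9%N (6 * j + 7)%N ltac:(rewrite /schur_skip /=; lia).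
have d11 := dS 10%N (6 * j + 8)%N ltac:(rewrite /schur_skip /=; lia).
have d12 := dS 11%N (6 * j + 8)%N ltac:(rewrite /schur_skip /=; lia).
(* Everything reduces to the values for [y] at [6 * j - 1] and [6 * j + 1]. With these and
   [q ^+ (6 * j)] as indeterminates, the claims are polynomial identities. *)
rewrite d12 d11 d10 d9 d8 d7 d5 IH6 IH4 IH2 e9 e8 e7 e6 e5 e4 e3 e2 /= /t /y.
by split; ring.
Qed.
End GeneratingFunction.

Definition count_schur (N : nat) (m n : int) : nat :=
  count (fun s => (m == Posz (schur_weight s)) && (n == Posz (sumn s)))
    (schur_upto N).

(** This replaces the passage to the limit: no part of a partition of [n] exceeds [n], so the bound
    [N] excludes nothing. *)
Lemma card_schurD_count (m n : int) (N : nat) :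
  n <= Posz N -> card_schurD m n = count_schur N m n.
Proof.
move=> nN; rewrite /card_schurD /count_schur -size_filter.
set p := (fun s => _).
have -> : fset_set (schurD m n) = seq_fset tt (filter p (schur_upto N)).
  apply/fsetP => s; rewrite in_fset_set; last exact: finite_schurD.
  rewrite seq_fsetE mem_filter mem_schur_upto.
  apply/idP/idP => [/set_mem[sS mS nS]|/andP[/andP[/eqP mS /eqP nS] /andP[sS _]]].
    rewrite /p -mS -nS !eqxx sS /=; move: nN; rewrite nS lez_nat; apply: leq_trans.
    by case: s {sS mS nS} => //= x s; apply: leq_addr.
  by apply/mem_set; split.
by rewrite size_seq_fset undup_id // filter_uniq // uniq_schur_upto.
Qed.

Lemma coef_bivariate_monomial (a b m n : nat) :
  (('X^a * ('X^b)%:P : {poly {poly int}})`_m)`_n = ((m == a) && (n == b))%:R.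
Proof.
by rewrite coefMC coefXn; case: eqP => _; rewrite ?mul1r ?mul0r ?coef0 ?coefXn.
Qed.

Lemma count_schur_recurrence (m n j : nat) :
  (count_schur (6 * j + 2) m n =
   count_schur (6 * j - 1) m (Posz n - 2 * Posz m) +
   count_schur (6 * j - 1) (Posz m - 1) (Posz n - 2 * Posz m + 1) +
   count_schur (6 * j - 1) (Posz m - 2) (Posz n - 2 * Posz m + 2))%N.
Proof.
(* The outer variable marks the weight, the inner one the size. *)
pose X : {poly {poly int}} := 'X; pose q : {poly {poly int}} := ('X)%:P.
have coef_gf (I : Type) (r : seq I) (a b : I -> nat) :
    ((\sum_(i <- r) X ^+ a i * q ^+ b i)`_m)`_n =
    (count (fun i => (m == a i) && (n == b i)) r)%:R.
  rewrite !coef_sum -sum1_count natr_sum [RHS]big_mkcond /=.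
  apply: eq_bigr => i _; rewrite -rmorphXn coef_bivariate_monomial.
  by case: ifP.
(* Replacing [X] by [X * q ^+ 2] adds twice the weight to the size; the factor in front then shifts
   both exponents by [i]. *)
have term i : X ^+ i * q ^+ i * schur_gf _ (X * q ^+ 2) q (6 * j - 1) =
   \sum_(s <- schur_upto (6 * j - 1))
      X ^+ (schur_weight s + i) * q ^+ (sumn s + 2 * schur_weight s + i).
  rewrite mulr_sumr; apply: eq_bigr => s _.
  by rewrite exprMn -exprM !exprD; ring.
have [+ _ _] := schur_gf_recurrence _ X q j.
have -> : 1 + X * q + X ^+ 2 * q ^+ 2 =
    X ^+ 0 * q ^+ 0 + X ^+ 1 * q ^+ 1 + X ^+ 2 * q ^+ 2 by ring.
rewrite !mulrDl !term => /(congr1 (fun p : {poly {poly int}} => p`_m`_n)).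
rewrite !coefD !coef_gf -!natrD => /eqP; rewrite eqr_nat => /eqP.
rewrite /count_schur => ->; congr (_ + _ + _)%N; apply: eq_count => s /=; lia.
Qed.

(** A bijection between the sets is to be a total function on [seq nat], which calls for a default
    value. *)
HB.instance Definition _ := isPointed.Build (seq nat) [::].

Theorem theorem4 (m n : int) (hm : 0 <= m) (hn : 0 <= n) :
  (exists phi : seq nat -> seq nat,
     set_bij (schurD m n)
       (schurD m (n - 2 * m)
          `|` schurD (m - 1) (n - 2 * m + 1)
          `|` schurD (m - 2) (n - 2 * m + 2))
       phi)
  /\ card_schurD m n =
       (card_schurD m (n - 2 * m)
        + card_schurD (m - 1) (n - 2 * m + 1)
        + card_schurD (m - 2) (n - 2 * m + 2))%N.
Proof.
have cardE : card_schurD m n =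
       (card_schurD m (n - 2 * m)
        + card_schurD (m - 1) (n - 2 * m + 1)
        + card_schurD (m - 2) (n - 2 * m + 2))%N.
  case: m n hm hn => m // [] n // _ _.
  (* Taking [j = n.+1] makes both bounds large enough: the sizes on the right are at most
     [n + 2]. *)
  rewrite (@card_schurD_count _ n (6 * n.+1 + 2)); last lia.
  rewrite !(@card_schurD_count _ _ (6 * n.+1 - 1)); [|lia..].
  exact: count_schur_recurrence.
split=> //; apply/card_set_bijP/fcard_eq.
- exact: finite_schurD.
- by rewrite !finite_setU; split; [split|]; apply: finite_schurD.
have disj m1 n1 m2 n2 : m1 != m2 ->
    [disjoint fset_set (schurD m1 n1) & fset_set (schurD m2 n2)]%fset.
  move=> m12; apply/fdisjointP => s.
  rewrite !in_fset_set; try exact: finite_schurD.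
  move=> /set_mem[_ e1 _]; apply/negP => /set_mem[_ e2 _].
  by rewrite e1 e2 eqxx in m12.
have cardU (A B : {fset seq nat}) : [disjoint A & B]%fset ->
    #|` (A `|` B)%fset| = (#|` A| + #|` B|)%N.
  by rewrite -leq_card_fsetU => /eqP.
have finD := finite_schurD.
rewrite !fset_setU ?finite_setU //; rewrite !cardU ?fdisjointUX ?disj //; lia.
Qed.
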